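(* Let $K$ be an infinite compact Hausdorff space with $gK=K$ (i.e. $K$ is extremally disconnected), where $g$ is the Gleason covering operator. Then the partially ordered set $\mathcal{S}(K,g)$ has a minimum if and only if $K=\beta D$ (up to homeomorphism) for some discrete space $D$, and in that case the minimum is $\alpha D$.
   Context: $\mathbf{Comp}$ is the category of compact Hausdorff spaces and continuous maps. For $X,Y\in\mathbf{Comp}$, a continuous surjection $f:Y\to X$ is a covering map if it is irreducible, i.e. $f(F)\neq X$ for every proper closed $F\subset Y$; then $(Y,f)$ is called a cover of $X$. For covers $(Y_1,f_1),(Y_2,f_2)$ of $X$, $(Y_1,f_1)\le (Y_2,f_2)$ means there is a continuous $f:Y_2\to Y_1$ with $f_2=f_1\circ f$; covers that are $\le$ each other are identified (the connecting map is then a homeomorphism), and $\operatorname{cov}X$ is the resulting ordered set. Each $X\in\mathbf{Comp}$ has a maximum cover $(gX,g_X)\in\operatorname{cov}X$, the Gleason cover; it is the unique cover of $X$ by an extremally disconnected compact space, and $gX=X$ (meaning $g_X$ is a homeomorphism) iff $X$ is extremally disconnected. $\mathcal{S}(K,g)=\{X\in\mathbf{Comp}: gX=K\}$, where $X$ is identified with the pair $(X,g_X)$, $g_X:K=gX\to X$; that is, the elements are pairs $(X,f)$ with $f:K\to X$ a covering map such that $(K,f)$ is the Gleason cover of $X$. The order is: $(X_1,f_1)\le(X_2,f_2)$ iff there is a continuous $f:X_2\to X_1$ with $f_1=f\circ f_2$; pairs that are $\le$ each other are identified. Saying that the minimum is $Z$ means that the least element is $Z$ with its covering map from $K$. $\alpha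 D$ is the one-point compactification of the infinite discrete space $D$, and $\beta D$ is its Čech–Stone compactification. *)

(* Defs.v *)
From HB Require Import structures.
From mathcomp Require Import all_boot all_order all_algebra.
From mathcomp Require Import all_classical all_reals all_analysis.
Set Implicit Arguments.
Unset Strict Implicit.
Unset Printing Implicit Defensive.

Local Open Scope classical_set_scope.

Definition comp_space (X : topologicalType) : Prop :=
  compact [set: X] /\ hausdorff_space X.

Definition homeomorphism (X Y : topologicalType) (f : X -> Y) : Prop :=
  continuous f /\ exists g : Y -> X, [/\ continuous g, cancel f g & cancel g f].

Definition embedding (X Y : topologicalType) (f : X -> Y) : Prop :=
  injective f /\
  forall U : set X, open U <-> exists2 V : set Y, open V & f @^-1` V = U.

Definition irreducible_map (Y X : topologicalType) (f : Y -> X) : Prop :=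
  forall F : set Y, closed F -> F <> [set: Y] -> f @` F <> [set: X].

Definition covering_map (Y X : topologicalType) (f : Y -> X) : Prop :=
  [/\ continuous f, range f = [set: X] & irreducible_map f].

Definition is_cover (X Y : topologicalType) (f : Y -> X) : Prop :=
  [/\ comp_space X, comp_space Y & covering_map f].

(* [(Y1, f1) <= (Y2, f2)] for covers of a fixed [X].  This is a preorder; the
   ordered set cov X is its quotient by mutual comparability. *)
Definition cover_le (X Y1 Y2 : topologicalType) (f1 : Y1 -> X) (f2 : Y2 -> X)
    : Prop :=
  exists2 f : Y2 -> Y1, continuous f & f2 = f1 \o f.

(* [(Y, f)] is (a representative of) the maximum [(gX, g_X)] of cov X. *)
Definition gleason_cover (X Y : topologicalType) (f : Y -> X) : Prop :=
  is_cover f /\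
  forall (Z : topologicalType) (h : Z -> X), is_cover h -> cover_le h f.

(* [gK = K]: the Gleason covering map of [K] is a homeomorphism. *)
Definition gleason_fixed (K : topologicalType) : Prop :=
  exists (Y : topologicalType) (gK : Y -> K),
    gleason_cover gK /\ homeomorphism gK.

(* [(X, f)] belongs to S(K, g), i.e. [X] is compact Hausdorff and [gX = K]
   with [g_X = f]; compactness of [X] is part of [is_cover]. *)
Definition in_S (K X : topologicalType) (f : K -> X) : Prop := gleason_cover f.

(* [(X1, f1) <= (X2, f2)] in S(K, g): unlike in [cover_le], the maps have a
   common source.  Pairs comparable both ways are identified, so a minimum of
   the quotient is the class of a pair below every pair. *)
Definition S_le (K X1 X2 : topologicalType) (f1 : K -> X1) (f2 : K -> X2)
    : Prop :=
  exists2 f : X2 -> X1, continuous f & f1 = f \o f2.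

Definition S_minimum (K X : topologicalType) (f : K -> X) : Prop :=
  in_S f /\
  forall (X' : topologicalType) (f' : K -> X'), in_S f' -> S_le f f'.

(* [(B, e)] is the Cech-Stone compactification of [D]: a Hausdorff
   compactification to which every continuous map from [D] to a compact
   Hausdorff space extends (uniquely, by density). *)
Definition stone_cech (D B : topologicalType) (e : D -> B) : Prop :=
  [/\ comp_space B, embedding e, dense (range e) &
    forall (Y : topologicalType) (h : D -> Y),
      comp_space Y -> continuous h ->
      exists2 h' : B -> Y, continuous h' & h' \o e = h].

(* Main.v *)
Require Import Defs.
From HB Require Import structures.
From mathcomp Require Import all_boot all_order all_algebra.
From mathcomp Require Import all_classical all_reals all_analysis.
Local Open Scope classical_set_scope.

(** The whole argument rests on one property of K: every closed relation from K
    to a compact Hausdorff space that is defined at every point of K has a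
    continuous selection ([closed_selection]).  It comes directly from gK = K:
    that equality makes every cover of K have a continuous section, and by
    Zorn's lemma every closed set mapping onto K contains a minimal one, on
    which the map is irreducible, hence a cover.

    Two consequences of selection are used.  Selecting in the relation
    f k = h z shows that every cover (K, f) of a space X lies above every other
    cover (Z, h) of X, so that S(K, g) consists of all covers with source K
    ([cover_gleason]).  Selecting in the relation that forces the value h d at
    each isolated point d extends any map h from the isolated points to all of
    K; so K is the Cech-Stone compactification of its set D of isolated points
    as soon as D is dense ([isolated_points_stone_cech]).

    If S(K, g) has a minimum f, then D is dense.  Gluing two non-isolated points
    p and q of K together is an irreducible quotient, so f factors through it
    and f p = f q.  Thus f is constant on the non-isolated points; a nonempty
    open set made of such points could be shrunk to a single one of them without
    changing the image of f, against irreducibility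
    ([S_minimum_isolated_dense]).

    Conversely let K be the Cech-Stone compactification of the discrete space D.
    The points of D are isolated in K, and an irreducible map is injective at
    isolated points: the fibre of f' (e d) is the single point e d.  The
    extension f of the inclusion of D into its one-point compactification sends
    e d to d and every other point to infinity, so it is irreducible and it is
    constant on the fibres of every irreducible f'; by compactness f' is a
    quotient map, so f factors continuously through f'
    ([stone_cech_S_minimum]). *)

(** * Compact Hausdorff spaces *)

(** Two points without disjoint neighbourhoods keep this property under a
    continuous map.  This is how Hausdorffness passes to products and subspaces,
    one separating map at a time. *)
Lemma continuous_cluster {S T : topologicalType} {f : S -> T} {p q : S} :
  continuous f -> hausdorff_space T -> cluster (nbhs p) q -> f p = f q.
Proof.
move=> fc hT pq; apply: hT => A B /fc nA /fc nB.
by have [x [Ax Bx]] := pq _ _ nA nB; exists (f x).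
Qed.

Lemma closed_equalizer {S T : topologicalType} {u v : S -> T} :
  continuous u -> continuous v -> hausdorff_space T ->
  closed [set x | u x = v x].
Proof.
move=> uc vc hT p clp; apply: hT => A B /uc nA /vc nB.
have [x [/= uv [Ax Bx]]] :
    [set x | u x = v x] `&` (u @^-1` A `&` v @^-1` B) !=set0.
  by apply: clp; exact: filterI.
by exists (u x); split => //; rewrite uv.
Qed.

Lemma hausdorff_closed1 {T : topologicalType} {x : T} :
  hausdorff_space T -> closed [set x].
Proof. by move=> hT; exact/accessible_closed_set1/hausdorff_accessible. Qed.

Lemma hausdorff_finite_closed {T : topologicalType} {A : set T} :
  hausdorff_space T -> finite_set A -> closed A.
Proof.
by move=> /hausdorff_accessible hT; exact: accessible_finite_set_closed.1 hT A.
Qed.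

Lemma comp_space_prod {S T : topologicalType} :
  comp_space S -> comp_space T -> comp_space (S * T)%type.
Proof.
move=> [cS hS] [cT hT]; split; first by rewrite -setXTT; exact: compact_setX.
move=> [a b] [c d] cl; congr pair.
  by apply: (@continuous_cluster _ _ fst) cl => // x; exact: cvg_fst.
by apply: (@continuous_cluster _ _ snd) cl => // x; exact: cvg_snd.
Qed.

Lemma comp_space_set_type {T : topologicalType} {B : set T} :
  comp_space T -> closed B -> comp_space (set_type B).
Proof.
move=> [cT hT] clB; split; last first.
  have vc : continuous (set_val : set_type B -> T) by exact: initial_continuous.
  by move=> p q /(continuous_cluster vc hT)/val_inj.
move=> F PF _.
have cB : compact B by exact: subclosed_compact clB cT _.
have [x [Bx clx]] : B `&` cluster (set_val @ F) !=set0.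
  apply: cB; rewrite /fmap/=.
  by apply: (@filterS _ F _ setT) => [y _|]; [exact: set_valP|exact: filterT].
exists (exist _ x (mem_set Bx)); split => // A N FA.
move=> [_ [[W oW <-] Wx WN]].
have nW : nbhs x W by exact: open_nbhs_nbhs.
have [|y [[a Aa ay] Wy]] := clx (set_val @` A) W _ nW.
  exact: (filterS (@preimage_image _ _ set_val A) FA).
by exists a; split => //; apply: WN; rewrite /= ay.
Qed.

Lemma closed_image {S T : topologicalType} {f : S -> T} {C : set S} :
  continuous f -> compact [set: S] -> hausdorff_space T -> closed C ->
  closed (f @` C).
Proof.
move=> fc cS hT clC; apply: compact_closed => //; apply: continuous_compact.
  exact: continuous_subspaceT.
exact: subclosed_compact clC cS _.
Qed.

(** A continuous surjection between compact Hausdorff spaces is closed, hence a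
    quotient map. *)
Lemma quotient_map_continuous {S T Y : topologicalType} {f : S -> T}
    {g : T -> Y} :
  continuous f -> range f = [set: T] -> compact [set: S] -> hausdorff_space T ->
  continuous (g \o f) -> continuous g.
Proof.
move=> fc fT cS hT /continuous_closedP gfc; apply/continuous_closedP => C clC.
rewrite (_ : g @^-1` C = f @` ((g \o f) @^-1` C)).
  by apply: closed_image => //; exact: gfc.
rewrite eqEsubset; split => [y Cy|_ [x Cx <-] //].
by have : [set: T] y by []; rewrite -fT => -[x _ xy]; exists x; rewrite //= xy.
Qed.

(** On an infinite set the cofinite filter is proper, but it has no cluster
    point when singletons are open. *)
Lemma compact_discrete_finite {T : topologicalType} :
  (forall x : T, open [set x]) -> compact [set: T] -> finite_set [set: T].
Proof.
move=> oT cT; apply: contrapT => infT.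
pose F := [set A : set T | finite_set (~` A)].
have PF : ProperFilter F.
  split; first by rewrite /F/= setC0.
  split; rewrite /F/=; first by rewrite setCT; exact: finite_set0.
    by move=> A B fA fB; rewrite /= setCI finite_setU.
  by move=> A B /subsetC AB; exact: sub_finite_set AB.
have [|x [_ Fx]] := cT F PF; first by rewrite /F/= setCT; exact: finite_set0.
have [||y [/= nyx yx]] := Fx (~` [set x]) [set x].
- by rewrite /F/= setCK; exact: finite_set1.
- exact: open_nbhs_nbhs.
- by [].
Qed.

(** Zorn's lemma, applied to the open sets whose removal from A leaves a set
    that still maps onto K.  For a chain of such sets, compactness of the fibre
    of f in A over each point k shows that the union of the chain cannot cover
    it unless a member does. *)
Lemma exists_minimal_closed {T K : topologicalType} {f : T -> K} {A : set T} :
  compact [set: T] -> continuous f -> (forall x : K, closed [set x]) ->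
  closed A -> f @` A = setT ->
  exists B, [/\ closed B, B `<=` A, f @` B = setT &
    forall C, closed C -> C `<=` B -> f @` C = setT -> C = B].
Proof.
move=> cT fc clK clA fA.
pose P U := open U /\ f @` (A `\` U) = setT.
have [F FP Ftot|U [[oU fU] Umax]] := @Zorn_bigcup T P.
  split; first by apply: bigcup_open => U /FP[].
  rewrite -subTset => k _.
  (* The union of the empty chain is empty, and A itself maps onto K. *)
  have [[X0 FX0]|F0] := pselect (F !=set0); last first.
    have : [set: K] k by []; rewrite -fA => -[a Aa <-]; exists a => //.
    by split => // -[X FX _]; apply: F0; exists X.
  apply: contrapT => nk.
  have /compact_near_coveringP cS : compact (A `&` f @^-1` [set k]).
    apply: subclosed_compact cT _ => //; apply: closedI => //.
    by move: fc => /continuous_closedP; exact.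
  (* The tails of the chain: what holds near G holds at some member. *)
  pose G := filter_from F (fun X => [set Y | F Y /\ X `<=` Y]).
  have FG : Filter G.
    apply: filter_from_filter; first by exists X0.
    move=> X Y FX FY; have [XY|YX] := Ftot _ _ FX FY.
      by exists Y => // Z [FZ YZ]; split; split => //; exact: subset_trans YZ.
    by exists X => // Z [FZ XZ]; split; split => //; exact: subset_trans XZ.
  have := cS _ G (fun X x => X x) FG; case=> [x [Ax /= fx]|X FX Xcov].
    have [X FX Xx] : exists2 X, F X & X x.
      by apply: contrapT => nX; apply: nk; exists x.
    exists (X, [set Y | F Y /\ X `<=` Y]).
      split; last by exists X.
      by apply: open_nbhs_nbhs; split => //; have [] := FP _ FX.
    by move=> [y Y] /= [Xy [_]]; exact.
  have [FX' fX] := FP _ FX.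
  have : [set: K] k by []; rewrite -fX => -[a [Aa nXa] ka].
  by apply: nXa; apply: (Xcov X (conj FX _) a) => //; exact: subset_refl.
exists (A `\` U); split => //.
- by rewrite setDE; apply: closedI => //; exact: open_closedC.
move=> C clC CB fC; apply/seteqP; split => // x [Ax nUx].
apply: contrapT => nCx; apply: (Umax (U `|` ~` C)).
  split=> [y|/(_ x) h]; first by left.
  by apply: nUx; apply: h; right.
split; first by apply: openU => //; exact: closed_openC.
rewrite -subTset -fC => _ [y Cy <-]; exists y => //; have [Ay nUy] := CB _ Cy.
by split => // -[].
Qed.

(** * Continuous selections and covers with source K *)

(** The identity of K is, up to homeomorphism, the largest cover of K. *)
Lemma gleason_fixed_section {K Z : topologicalType} {h : Z -> K} :
  comp_space K -> gleason_fixed K -> is_cover h ->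
  exists2 s : K -> Z, continuous s & cancel s h.
Proof.
move=> cK [Y [gK [[_ maxg] [gc [g' [g'c gg' g'g]]]]]] /maxg[s sc gs].
exists (s \o g') => [x|x /=].
  by apply: continuous_comp; [exact: g'c|exact: sc].
by rewrite -[RHS]g'g gs.
Qed.

(** On a minimal closed subset B of A that maps onto K, the restriction of f is
    irreducible, so B is a cover of K and has a section. *)
Lemma closed_selection {K P : topologicalType} {f : P -> K} {A : set P} :
  comp_space K -> gleason_fixed K -> comp_space P -> continuous f ->
  closed A -> f @` A = setT ->
  exists s : K -> P, [/\ continuous s, cancel s f & forall k, A (s k)].
Proof.
move=> cK gK cP fc clA fA.
have [B [clB BA fB Bmin]] := exists_minimal_closed cP.1 fc
  (fun _ => hausdorff_closed1 cK.2) clA fA.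
have vc : continuous (set_val : set_type B -> P) by exact: initial_continuous.
have [|s sc sK] := @gleason_fixed_section K (set_type B) (f \o set_val) cK gK.
  split => //; first exact: comp_space_set_type.
  split.
  - by move=> x; apply: continuous_comp; [exact: vc|exact: fc].
  - rewrite -subTset -fB => _ [x Bx <-].
    by exists (exist _ x (mem_set Bx)).
  - move=> C clC CT; apply: contra_not CT => fC.
    have vC : set_val @` C = B.
      apply: Bmin; last by rewrite -fC image_comp.
      - exact: closed_image vc (comp_space_set_type cP clB).1 cP.2 clC.
      - by move=> _ [x _ <-]; exact: set_valP.
    rewrite -subTset => x _.
    have [y Cy /val_inj <- //] : (set_val @` C) (set_val x).
      by rewrite vC; exact: set_valP.
exists (set_val \o s); split => // [x|k].
  by apply: continuous_comp; [exact: sc|exact: vc].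
exact/BA/set_valP.
Qed.

(** Projectivity of K: select in the fibre product of f and h over X. *)
Lemma cover_gleason {K X : topologicalType} {f : K -> X} :
  gleason_fixed K -> is_cover f -> gleason_cover f.
Proof.
move=> gK cf; split => // Z h [_ cZ [hc hT _]].
have [cX cK [fc fT _]] := cf.
have fstc : continuous (@fst K Z) by move=> x; exact: cvg_fst.
have sndc : continuous (@snd K Z) by move=> x; exact: cvg_snd.
pose A := [set p : K * Z | (f \o fst) p = (h \o snd) p].
have [||||s [sc sK sA]] := @closed_selection K (K * Z)%type fst A cK gK.
- exact: comp_space_prod.
- exact: fstc.
- apply: closed_equalizer cX.2 => x; apply: continuous_comp.
  + exact: fstc.
  + exact: fc.
  + exact: sndc.
  + exact: hc.
- rewrite -subTset => k _; have : [set: X] (f k) by [].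
  by rewrite -hT => -[z _ hz]; exists (k, z).
exists (snd \o s) => [x|].
  by apply: continuous_comp; [exact: sc|exact: sndc].
by apply/funext => k /=; rewrite -[LHS](congr1 f (sK k)); exact: sA.
Qed.

(** * Isolated points *)

(** The closed relation to select in puts no condition above a non-isolated
    point and imposes the value h d above an isolated point d; it is closed
    because isolated points form open sets. *)
Lemma isolated_points_stone_cech {K : topologicalType} :
  comp_space K -> gleason_fixed K -> dense [set x : K | open [set x]] ->
  stone_cech
    (set_val : discrete_topology (set_type [set x : K | open [set x]]) -> K).
Proof.
set E := [set x | _]; move=> cK gK dE; split => //.
- split; first exact: val_inj.
  move=> U; split => _; last exact: discrete_open.
  exists (set_val @` U).
    rewrite openE => _ [d Ud <-]; apply: filterS (_ : nbhs _ [set set_val d]).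
      by move=> _ ->; exists d.
    by apply: open_nbhs_nbhs; split => //; exact: (set_valP d).
  apply/seteqP; split => [d [d' Ud' /val_inj <-] //|d Ud]; by exists d.
- move=> U U0 oU; have [x [Ux Ex]] := dE U U0 oU.
  by exists x; split => //; exists (exist _ x (mem_set Ex)).
move=> Y h cY _.
have fstc : continuous (@fst K Y) by move=> x; exact: cvg_fst.
have sndc : continuous (@snd K Y) by move=> x; exact: cvg_snd.
pose A := \bigcap_(d in [set: set_type E])
  (fst @^-1` (~` [set set_val d]) `|` snd @^-1` [set h d]) : set (K * Y).
have [||||s [sc sK sA]] := @closed_selection K (K * Y)%type fst A cK gK.
- exact: comp_space_prod.
- exact: fstc.
- apply: closed_bigI => d _; apply: closedU.
    apply: preimage_closed; first by move=> *; exact: fstc.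
    by apply: open_closedC; exact: (set_valP d).
  apply: preimage_closed; first by move=> *; exact: sndc.
  exact: hausdorff_closed1 cY.2.
- rewrite -subTset => k _.
  have [Ek|nEk] := pselect (E k).
    exists (k, h (exist _ k (mem_set Ek))) => // d _ /=.
    have [<-|] := pselect (d = exist _ k (mem_set Ek)); first by right.
    by move=> nd; left => kd; apply: nd; apply: val_inj.
  (* Any value will do here; density provides one through some h x. *)
  have [x [_ Ex]] : setT `&` E !=set0 by apply: dE; [exists k|exact: openT].
  exists (k, h (exist _ x (mem_set Ex))) => // d _; left => /= kd.
  by apply: nEk; rewrite kd; exact: (set_valP d).
exists (snd \o s) => [x|].
  by apply: continuous_comp; [exact: sc|exact: sndc].
by apply/funext => d /=; case: (sA (set_val d) d I) => /=.
Qed.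

(** * Gluing two points together *)

Definition pinch {K : topologicalType} (p q x y : K) :=
  (x == y) || (x \in pred2 p q) && (y \in pred2 p q).

Lemma pinch_equiv {K : topologicalType} (p q : K) : equiv_class_of (pinch p q).
Proof.
split=> [x|x y|y x z]; rewrite /pinch; first by rewrite eqxx.
  by rewrite eq_sym andbC.
case/orP=> [/eqP->//|/andP[px py]].
case/orP=> [/eqP<-|/andP[_ pz]]; first by rewrite px py orbT.
by rewrite px pz orbT.
Qed.

Definition pinch_equiv_rel {K : topologicalType} (p q : K) :=
  EquivRelPack (pinch_equiv p q).

Definition pinch_space {K : topologicalType} (p q : K) : topologicalType :=
  quotient_topology {eq_quot pinch_equiv_rel p q}%qT.

Definition pinch_map {K : topologicalType} (p q : K) : K -> pinch_space p q :=
  \pi_(pinch_space p q)%qT.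

Lemma pinch_map_eq {K : topologicalType} (p q x y : K) :
  pinch_map p q x = pinch_map p q y <-> pinch p q x y.
Proof. by split => [/eqmodP|?]; last exact/eqmodP. Qed.

Lemma pinch_map_surj {K : topologicalType} (p q : K) :
  range (pinch_map p q) = setT.
Proof. by rewrite -subTset => y _; exists (repr y) => //; exact: reprK. Qed.

Lemma separate {T : topologicalType} {x y : T} : hausdorff_space T -> x <> y ->
  exists U V : set T, [/\ open U, open V, U x, V y & U `&` V = set0].
Proof.
rewrite open_hausdorff => + /eqP xy => /(_ _ _ xy)[[U V]] /=.
by move=> [/set_mem Ux /set_mem Vy] [oU oV /eqP UV]; exists U, V.
Qed.

Lemma pinch_saturated_image_open {K : topologicalType} (p q : K) (U : set K) :
  open U -> (forall x y, U x -> pinch p q x y -> U y) ->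
  open (pinch_map p q @` U).
Proof.
move=> oU sU; rewrite /open/= /quotient_open.
rewrite (_ : _ @^-1` _ = U) //; apply/seteqP; split => [x [y Uy]|x Ux].
  by move=> /pinch_map_eq; exact: sU.
by exists x.
Qed.

(** Disjoint open neighbourhoods of two inequivalent points can be chosen
    saturated.  Both avoid the pair p, q if neither point belongs to it; if one
    point does, its neighbourhood is taken to contain the whole pair, which
    makes the other one avoid the pair. *)
Lemma pinch_hausdorff {K : topologicalType} (p q : K) :
  hausdorff_space K -> hausdorff_space (pinch_space p q).
Proof.
move=> hK.
have sep a b : ~ pinch p q a b -> exists U V : set K,
    [/\ open U, open V, U a, V b & [/\ U `&` V = set0,
     (forall x y, U x -> pinch p q x y -> U y) &
     (forall x y, V x -> pinch p q x y -> V y)]].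
  (* One of two inequivalent points lies outside the pair; let it be b. *)
  wlog nb : a b / b \notin pred2 p q.
    have [bE|nbE] := boolP (b \in pred2 p q); last by move=> H; exact: H.
    have [aE|naE] := boolP (a \in pred2 p q).
      by move=> _; rewrite /pinch aE bE orbT.
    move=> H nab; have [|U [V [oU oV Ub Va [UV sU sV]]]] := H b a naE.
      case/orP => [/eqP ba|/andP[_]]; last by rewrite (negbTE naE).
      by apply: nab; rewrite ba /pinch eqxx.
    by exists V, U; split => //; split => //; rewrite setIC.
  move=> nab.
  have sub_sat (W : set K) : (forall x, W x -> x \notin pred2 p q) ->
      forall x y, W x -> pinch p q x y -> W y.
    by move=> nW x y Wx /orP[/eqP<-//|/andP[+ _]]; rewrite (negbTE (nW x Wx)).
  have [bp bq] : b <> p /\ b <> q.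
    by move: nb; rewrite !inE negb_or => /andP[/eqP ? /eqP ?].
  have [Vp [Up [oVp oUp Vpb Upp VUp]]] := separate hK bp.
  have [Vq [Uq [oVq oUq Vqb Uqq VUq]]] := separate hK bq.
  have VU x : (Vp `&` Vq) x -> (Up `|` Uq) x -> False.
    move=> [vp vq] [up|uq].
      by have : (Vp `&` Up) x by []; rewrite VUp.
    by have : (Vq `&` Uq) x by []; rewrite VUq.
  have Epq x : x \in pred2 p q -> (Up `|` Uq) x.
    by rewrite inE => /orP[]/eqP->; [left|right].
  have [aE|naE] := boolP (a \in pred2 p q).
    exists (Up `|` Uq), (Vp `&` Vq); split => //.
    - exact: openU.
    - exact: openI.
    - exact: Epq.
    split.
    - by rewrite -subset0 => x [Ux Vx]; exact: (VU x).
    - by move=> x y Ux /orP[/eqP<-//|/andP[_ /Epq]].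
    - by apply: sub_sat => x Vx; apply/negP => /Epq; exact: VU Vx.
  have ab : a <> b by move=> ab; apply: nab; rewrite ab /pinch eqxx.
  have [U [V [oU oV Ua Vb UV]]] := separate hK ab.
  pose W := ~` ([set p] `|` [set q]).
  have oW : open W.
    by apply: closed_openC; apply: closedU; exact: hausdorff_closed1.
  have Wn x : W x <-> x \notin pred2 p q.
    rewrite /W/= !inE negb_or; split.
      by move=> /not_orP[/eqP-> /eqP->].
    by move=> /andP[/eqP ? /eqP ?] [].
  exists (U `&` W), (V `&` W); split.
  - exact: openI.
  - exact: openI.
  - by split => //; exact/Wn.
  - by split => //; exact/Wn.
  split.
  - by rewrite -subset0 => x [[Ux _] [Vx _]]; rewrite -UV.
  - by apply: sub_sat => x [_ /Wn].
  - by apply: sub_sat => x [_ /Wn].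
rewrite open_hausdorff => x y xy.
have [|U [V [oU oV Ux Vy [UV sU sV]]]] := sep (repr x) (repr y).
  move=> /pinch_map_eq; rewrite /pinch_map !reprK => xy'.
  by rewrite xy' eqxx in xy.
exists (pinch_map p q @` U, pinch_map p q @` V) => /=.
  by rewrite !inE; split; [exists (repr x)|exists (repr y)] => //; exact: reprK.
split; try exact: pinch_saturated_image_open.
apply/eqP; rewrite -subset0 => _ [[a Ua <-] [b Vb /esym/pinch_map_eq ab]].
have : (U `&` V) b by split; [exact: sU Ua ab|].
by rewrite UV.
Qed.

(** A proper closed set that still maps onto the quotient can only miss p and q,
    so one of these two points would be isolated. *)
Lemma pinch_cover {K : topologicalType} (p q : K) :
  comp_space K -> ~ open [set p] -> ~ open [set q] -> is_cover (pinch_map p q).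
Proof.
move=> [cK hK] np nq.
have pc : continuous (pinch_map p q) by exact: pi_continuous.
split => //.
  split; last exact: pinch_hausdorff.
  rewrite -(pinch_map_surj p q); apply: continuous_compact => //.
  exact: continuous_subspaceT.
split => //; first exact: pinch_map_surj.
move=> F clF FT; apply: contra_not FT => pF; rewrite -subTset => x _.
apply: contrapT => nFx.
have nF y : ~ F y -> y \in pred2 p q.
  move=> nFy; have : [set: pinch_space p q] (pinch_map p q y) by [].
  rewrite -pF => -[z Fz /pinch_map_eq/orP[/eqP zy|/andP[]//]].
  by rewrite -zy in nFy.
have ox : open [set x].
  rewrite (_ : [set x] = ~` F `&` ~` ([set p; q] `\ x)).
    apply: openI; first exact: closed_openC.
    apply: closed_openC; apply: hausdorff_finite_closed hK _.
    exact: sub_finite_set (@subDsetl _ _ _) (finite_set2 p q).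
  apply/seteqP; split => [_ ->|y [/nF]].
    by split => // -[_]; apply.
  rewrite inE /= => ypq; apply: contra_notP => yx; split=> //.
  by case/orP: ypq => /eqP->; [left|right].
by have := nF x nFx; rewrite inE => /orP[]/eqP xE; move: ox; rewrite xE.
Qed.

(** The minimum factors through the gluing of any two non-isolated points, so it
    identifies all of them. *)
Lemma S_minimum_isolated_dense {K X : topologicalType} {f : K -> X} :
  comp_space K -> gleason_fixed K -> S_minimum f ->
  dense [set x : K | open [set x]].
Proof.
move=> cK gK [[[_ _ [_ fX fI]] _] fmin].
have fpq p q : ~ open [set p] -> ~ open [set q] -> f p = f q.
  move=> np nq.
  have [g _ ->] := fmin _ _ (cover_gleason gK (pinch_cover p q cK np nq)).
  rewrite /= (_ : pinch_map p q p = pinch_map p q q) //.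
  by apply/pinch_map_eq; rewrite /pinch !inE !eqxx !orbT.
move=> U [u Uu] oU; apply: contrapT => UI.
have nU x : U x -> ~ open [set x] by move=> Ux ox; apply: UI; exists x.
(* All of U has the same image as its point u. *)
apply: (fI (~` U `|` [set u])).
- by apply: closedU; [exact: open_closedC|exact: hausdorff_closed1 cK.2].
- move=> /seteqP[_ Uu1]; apply: (nU u Uu).
  rewrite (_ : [set u] = U) //; apply/seteqP; split => [_ -> //|x Ux].
  by have [] := Uu1 x I.
- rewrite -subTset -fX => _ [x _ <-].
  have [Ux|nUx] := pselect (U x); last by exists x => //; left.
  by exists u; [right|apply: fpq; exact: nU].
Qed.

(** * The one-point compactification as minimum *)

Lemma discrete_one_point_comp (D : discreteTopologicalType) :
  comp_space (one_point_compactification D).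
Proof.
split; first exact: one_point_compactification_compact.
apply: one_point_compactification_hausdorff; last exact: discrete_hausdorff.
move=> x _; exists [set x]; last first.
  by split; [exact: compact_set1|exact: discrete_closed].
by rewrite withinET; exact: discrete_set1.
Qed.

(** An open set that meets the image of e only in e d is reduced to that point,
    since the image is dense and points are closed. *)
Lemma embedded_discrete_isolated {D : discreteTopologicalType}
    {K : topologicalType} {e : D -> K} (d : D) :
  hausdorff_space K -> embedding e -> dense (range e) -> open [set e d].
Proof.
move=> hK [einj eopen] eD.
have [V oV Vd] := (eopen [set d]).1 (discrete_open _).
suff -> : [set e d] = V by [].
apply/seteqP; split => [_ ->|x Vx].
  by have : [set d] d by []; rewrite -Vd.
apply: contrapT => xd.
have [||y [[Vy nyd] [d' _ d'y]]] := eD (V `&` ~` [set e d]).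
- by exists x.
- by apply: openI => //; apply: closed_openC; exact: hausdorff_closed1.
have : [set d] d' by rewrite -Vd /= d'y.
by move=> dd'; apply: nyd; rewrite -d'y dd'.
Qed.

(** If another point had the same image as the isolated point x, the closed
    complement of x would still map onto X. *)
Lemma cover_fiber_isolated {K X : topologicalType} {f : K -> X} {x y : K} :
  covering_map f -> open [set x] -> f x = f y -> x = y.
Proof.
move=> [_ fX fI] ox fxy; apply: contrapT => xy.
apply: (fI (~` [set x])); first exact: open_closedC.
  by move=> /seteqP[_ /(_ x I)]; apply.
rewrite -subTset -fX => _ [z _ <-].
have [->|zx] := pselect (z = x); last by exists z.
by exists y => // yx; apply: xy.
Qed.

(** The minimum is the extension f of the inclusion of D; it collapses to
    infinity everything outside D. *)
Lemma stone_cech_S_minimum {K : topologicalType} {D : discreteTopologicalType}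
    {e : D -> K} :
  infinite_set [set: K] -> gleason_fixed K -> stone_cech e ->
  exists f : K -> one_point_compactification D, f \o e = Some /\ S_minimum f.
Proof.
move=> Kinf gK [cK eemb eD eext].
have cA := discrete_one_point_comp D.
have [f fc fe] := eext _ _ cA one_point_compactification_some_continuous.
have feE d : f (e d) = Some d by rewrite -[LHS]/((f \o e) d) fe.
have fibre d x : f x = Some d -> x = e d.
  move=> fx; apply: contrapT => xd.
  have oU : open (f @^-1` [set Some d] `&` ~` [set e d]).
    apply: openI; last by apply: closed_openC; exact: hausdorff_closed1 cK.2.
    move: fc => /continuousP; apply; rewrite -image_set1.
    by apply: one_point_compactification_open_some; exact: discrete_open.
  have [|y [[/= fy nyd] [d' _ d'y]]] := eD _ _ oU; first by exists x.
  by apply: nyd; rewrite -d'y; move: fy; rewrite -d'y feE => -[->].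
have fcov : covering_map f.
  split => //.
    rewrite -subTset => -[d|] _; first by exists (e d).
    apply: contrapT => nN.
    have clR : closed (range f).
      by apply: closed_image fc cK.1 cA.2 _; exact: closedT.
    have : nbhs (None : one_point_compactification D) (~` range f).
      by apply: open_nbhs_nbhs; split => //; exact: closed_openC.
    move=> [C [cC _] CR].
    have CT : C = setT.
      rewrite -subTset => d _; apply: contrapT => nCd.
      by apply: (CR (Some d)); [left; exists d|exists (e d)].
    (* Infinity outside the closed image would be isolated, making D compact. *)
    have finD : finite_set [set: D].
      apply: compact_discrete_finite; last by rewrite -CT.
      by move=> d; exact: discrete_open.
    apply: Kinf; rewrite (_ : [set: K] = range e); first exact: finite_image.
    apply/esym; rewrite -subTset => k _; apply: contrapT => nk.
    have [||x [nx rx]] := eD (~` range e); [by exists k| |exact: nx].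
    apply: closed_openC; apply: hausdorff_finite_closed cK.2 _.
    exact: finite_image.
  move=> F clF FT; apply: contra_not FT => fF.
  have eF d : F (e d).
    have : [set: one_point_compactification D] (Some d) by [].
    by rewrite -fF => -[x Fx /fibre <-].
  rewrite -subTset => x _; apply: contrapT => nFx.
  have [||y [nFy [d _ dy]]] := eD (~` F); [by exists x|exact: closed_openC|].
  by apply: nFy; rewrite -dy.
exists f; split => //; split; first exact: cover_gleason.
move=> X f' [[cX _ [f'c f'X f'I]] _].
have f'r x : exists k, f' k = x.
  by have : [set: X] x by []; rewrite -f'X => -[k _ <-]; exists k.
have [r rK] := choice f'r.
have e1 k d : f' k = f' (e d) -> k = e d.
  move=> kd; apply/esym; apply: (@cover_fiber_isolated K X f') => //.
  exact: embedded_discrete_isolated cK.2 eemb eD.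
have fr k : f (r (f' k)) = f k.
  have rk : f' (r (f' k)) = f' k by [].
  case fk : (f k) => [d|].
    by move: (rk); rewrite {2}(fibre d k fk) => /e1 ->; exact: feE.
  case frk : (f (r (f' k))) => [d|] //.
  by move: (esym rk); rewrite (fibre _ _ frk) => /e1 kd; rewrite kd feE in fk.
exists (f \o r).
  apply: (quotient_map_continuous f'c f'X cK.1 cX.2).
  rewrite (_ : _ \o f' = f) //; exact/funext.
by apply/funext => k /=; rewrite fr.
Qed.

Theorem theorem5p5 (K : topologicalType) (Kcomp : comp_space K)
    (Kinf : infinite_set [set: K]) (gK : gleason_fixed K) :
  ((exists (X : topologicalType) (f : K -> X), S_minimum f) <->
   (exists (D : discreteTopologicalType) (e : D -> K), stone_cech e)) /\
  (forall (D : discreteTopologicalType) (e : D -> K), stone_cech e ->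
     exists f : K -> one_point_compactification D,
       f \o e = Some /\ S_minimum f).
Proof.
split; last by move=> D e; exact: stone_cech_S_minimum.
split => [[X [f fmin]]|[D [e De]]].
  have dI := S_minimum_isolated_dense Kcomp gK fmin.
  by do 2!eexists; exact: isolated_points_stone_cech Kcomp gK dI.
have [f [_ fmin]] := stone_cech_S_minimum Kinf gK De.
by exists (one_point_compactification D), f.
Qed.
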